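(* Let $d,s\ge1$ and $n\ge d+1$ be integers, let $\alpha>0$ be real, and let $F_1,\ldots,F_n\subseteq\mathbb{R}^d$ be $s$-convex sets. If at least $\alpha\binom{n}{d+1}$ of the $(d+1)$-tuples of these sets (i.e. of the $(d+1)$-element index sets $I\subseteq\{1,\dots,n\}$) intersect, meaning $\bigcap_{i\in I}F_i\ne\emptyset$, then some point of $\mathbb{R}^d$ belongs to at least $$\frac{\alpha n}{(d+1)s^d}$$ of the sets $F_1,\ldots,F_n$.
   Context: A set in $\mathbb{R}^d$ is called $s$-convex if it is the union of at most $s$ convex sets. *)

(* Defs.v *)
From mathcomp Require Import all_boot all_order all_algebra.
From mathcomp Require Import boolp classical_sets reals convex.

Set Implicit Arguments.
Unset Strict Implicit.
Unset Printing Implicit Defensive.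

Import Order.TTheory GRing.Theory Num.Theory.
Local Open Scope classical_set_scope.
Local Open Scope ring_scope.

(* The pieces of the union may overlap, coincide or be empty. *)
Definition s_convex (R : realType) (d s : nat) (A : set 'rV[R]_d) : Prop :=
  exists (k : nat) (C : 'I_k -> set 'rV[R]_d),
    [/\ (k <= s)%N,
        forall j, convex_set (C j) &
        A = \bigcup_(j in [set: 'I_k]) C j].

(* A tuple is an unordered (d+1)-element index set; repeated members of the
   family F count separately. *)
Definition intersecting_tuples (R : realType) (d n : nat)
    (F : 'I_n -> set 'rV[R]_d) : {set {set 'I_n}} :=
  [set I : {set 'I_n} | (#|I| == d.+1)
     && `[< (\bigcap_(i in [set` I]) F i) !=set0 >] ]%SET.

(* Main.v *)
(*
Replace each convex piece by the hull of finitely many witnesses, so that all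
pieces are compact. If d+1 compact convex sets meet, the point of their
intersection nearest to the origin is already the nearest point of the
intersection of some d of them: otherwise the d+1 sets together with the open
ball of radius the minimal norm would violate Helly's theorem. So every
intersecting (d+1)-tuple, with one piece chosen in each member, is assigned d
indices with d pieces whose nearest point lies in all d+1 sets. There are only
C(n,d) s^d possible values, hence one of them is hit by at least
alpha (n-d) / ((d+1) s^d) tuples; each of these tuples adds a different set to
the d sets containing the corresponding point.
*)
Require Import Defs.
From mathcomp Require Import all_boot all_order all_algebra.
From mathcomp Require Import boolp classical_sets reals convex.
From mathcomp Require Import unstable interval_inference topology.
From mathcomp Require Import normedtype derive ring lra.

Set Implicit Arguments.
Unset Strict Implicit.
Unset Printing Implicit Defensive.

Import Order.TTheory GRing.Theory Num.Theory.
Import numFieldNormedType.Exports.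
Local Open Scope classical_set_scope.
Local Open Scope ring_scope.

(** * Convex combinations *)

Lemma convex_set_comb (R : realType) (V : lmodType R) (D : set V)
    (x y : V) (a b : R) :
  convex_set D -> D x -> D y -> 0 <= a -> 0 <= b -> a + b = 1 ->
  D (a *: x + b *: y).
Proof.
move=> cD Dx Dy a0 b0 ab1.
have a1 : a <= 1 by lra.
have := cD x y (Itv01 a0 a1) (mem_set Dx) (mem_set Dy).
rewrite inE /conv/= /onem.
by rewrite (_ : 1 - a = b) //; lra.
Qed.

Lemma convex_set_intro (R : realType) (V : lmodType R) (D : set V) :
  (forall (x y : V) (a b : R), D x -> D y -> 0 <= a -> 0 <= b -> a + b = 1 ->
    D (a *: x + b *: y)) -> convex_set D.
Proof.
move=> cD x y l /set_mem Dx /set_mem Dy; apply/mem_set/cD => //.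
- by rewrite onem_ge0.
- by rewrite addrC subrK.
Qed.

Lemma convex_set_sum (R : realType) (V : lmodType R) (D : set V) (I : Type)
    (r : seq I) (P : pred I) (w : I -> R) (z : I -> V) :
  convex_set D -> (forall i, P i -> 0 <= w i) ->
  (forall i, P i -> D (z i)) -> 0 < \sum_(i <- r | P i) w i ->
  D ((\sum_(i <- r | P i) w i)^-1 *: \sum_(i <- r | P i) w i *: z i).
Proof.
move=> cD w0 Dz.
(* The first alternative covers sums all of whose weights vanish. *)
pose K S v := (S = 0 /\ v = 0) \/ (0 < S /\ D (S^-1 *: v)).
suff : K (\sum_(i <- r | P i) w i) (\sum_(i <- r | P i) w i *: z i).
  by case=> [[-> _]|[]//]; rewrite ltxx.
apply: big_ind2 => [|S1 v1 S2 v2|i Pi].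
- by left.
- case=> [[-> ->]|[S10 D1]]; first by rewrite !add0r.
  case=> [[-> ->]|[S20 D2]]; first by rewrite !addr0; right.
  right; split; first exact: addr_gt0.
  have S12 : S1 + S2 != 0 by rewrite gt_eqF// addr_gt0.
  have := @convex_set_comb _ _ D _ _ (S1 / (S1 + S2)) (S2 / (S1 + S2)) cD D1 D2.
  have sc S v : 0 < S -> S / (S1 + S2) *: (S^-1 *: v) = (S1 + S2)^-1 *: v :> V.
    by move=> S0; rewrite scalerA mulrAC divff ?gt_eqF// mul1r.
  rewrite !sc// -scalerDr; apply.
  + by rewrite divr_ge0 ?addr_ge0 ?ltW.
  + by rewrite divr_ge0 ?addr_ge0 ?ltW.
  + by rewrite -mulrDl divff.
- have := w0 i Pi; rewrite le_eqVlt => /predU1P[<-|wi0].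
    by left; rewrite scale0r.
  by right; rewrite scalerA mulVf ?gt_eqF// scale1r; split => //; exact: Dz.
Qed.

(** * Affine dependence and Helly's theorem *)

Lemma affine_dependence (R : fieldType) (d m : nat) (z : 'I_m -> 'rV[R]_d) :
  (d.+1 < m)%N -> exists w : 'I_m -> R,
  [/\ exists i, w i != 0, \sum_i w i = 0 & \sum_i w i *: z i = 0].
Proof.
move=> dm.
(* The column of ones makes the kernel relations affine. *)
pose M : 'M[R]_(m, 1 + d) := \matrix_i row_mx 1 (z i).
have /rowV0Pn[v /sub_kermxP vM v0] : kermx M != 0.
  rewrite kermx_eq0 /row_free neq_ltn (leq_ltn_trans (rank_leq_col M))//.
have : row_mx (\sum_i v 0 i)%:M (\sum_i v 0 i *: z i) = row_mx 0 0.
  rewrite row_mx0 -vM mulmx_sum_row.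
  under [RHS]eq_bigr do rewrite rowK scale_row_mx.
  rewrite -[RHS]hsubmxK; congr row_mx.
  - rewrite linear_sum/=; under [RHS]eq_bigr do rewrite row_mxKl.
    by rewrite -scaler_suml scalemx1.
  - by rewrite linear_sum/=; under [RHS]eq_bigr do rewrite row_mxKr.
case/eq_row_mx => w0 wz0.
exists (v 0); split => //.
- by move/rV0Pn : v0.
- by have /matrixP/(_ 0 0) := w0; rewrite !mxE eqxx mulr1n.
Qed.

(** Radon's argument: in an affine dependence the positive and the nonpositive weights have the same
    barycentre. If [w u] is positive, write it with the points [z i] of nonpositive weight, all of
    which lie in [D u]; otherwise with those of positive weight. *)
Lemma helly_points_ord (R : realType) (d m : nat)
    (z : 'I_m -> 'rV[R]_d) (D : 'I_m -> set 'rV[R]_d) :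
  (d.+1 < m)%N -> (forall i, convex_set (D i)) ->
  (forall i j, i != j -> D i (z j)) ->
  exists x, forall i, D i x.
Proof.
move=> dm cD Dz; have [w [[k wk0] w0 wz0]] := @affine_dependence _ _ _ z dm.
pose P i := 0 < w i; pose S := \sum_(i | P i) w i.
have SE : \sum_(i | ~~ P i) - w i = S.
  apply/esym/eqP; rewrite sumrN -subr_eq0 opprK -[X in _ == X]w0.
  by rewrite [X in _ == X](bigID P).
have xE : \sum_(i | ~~ P i) - w i *: z i = \sum_(i | P i) w i *: z i.
  under eq_bigr do rewrite scaleNr.
  apply/esym/eqP; rewrite sumrN -subr_eq0 opprK -[X in _ == X]wz0.
  by rewrite [X in _ == X](bigID P).
have nP i : ~~ P i -> 0 <= - w i by rewrite /P -leNgt oppr_ge0.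
have S0 : 0 < S.
  have [Pk|nPk] := boolP (P k).
    rewrite /S (bigD1 k)//= ltr_pwDl// sumr_ge0// => i /andP[/ltW//].
  rewrite -SE (bigD1 k)//= ltr_pwDl//.
    by rewrite lt_neqAle nP// andbT eq_sym oppr_eq0.
  by rewrite sumr_ge0// => i /andP[/nP].
exists (S^-1 *: \sum_(i | P i) w i *: z i) => u.
have [Pu|nPu] := boolP (P u).
  rewrite -xE -SE; apply: convex_set_sum => //; last by rewrite SE.
  by move=> i nPi; apply: Dz; apply: contraNneq nPi => <-.
apply: convex_set_sum => // [i /ltW//|i Pi].
by apply: Dz; apply: contraNneq nPu => ->.
Qed.

Lemma helly_points (R : realType) (d : nat) (U : finType) (A : {set U})
    (z : U -> 'rV[R]_d) (D : U -> set 'rV[R]_d) :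
  (d.+1 < #|A|)%N -> (forall u, u \in A -> convex_set (D u)) ->
  (forall u v, u \in A -> v \in A -> u != v -> D u (z v)) ->
  exists x, forall u, u \in A -> D u x.
Proof.
move=> dA cD Dz.
have [i|i j ij|x Dx] :=
    @helly_points_ord R d #|A| (z \o enum_val) (D \o enum_val) dA.
- exact/cD/enum_valP.
- by apply: Dz; rewrite ?enum_valP// (inj_eq enum_val_inj).
by exists x => u uA; have := Dx (enum_rank_in uA u); rewrite /= enum_rankK_in.
Qed.

(** * Squared Euclidean norm and nearest points *)

Lemma continuous_sumr (R : realType) (V : normedModType R) (T : topologicalType)
    (I : finType) (f : I -> T -> V) :
  (forall i, continuous (f i)) -> continuous (fun x => \sum_i f i x).
Proof. by move=> cf; apply: continuous_big => //; exact: add_continuous. Qed.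

Definition sqnorm (R : realType) (d : nat) (x : 'rV[R]_d) : R :=
  \sum_j x 0 j ^+ 2.

Lemma sqnorm_ge0 (R : realType) (d : nat) (x : 'rV[R]_d) : 0 <= sqnorm x.
Proof. by apply: sumr_ge0 => j _; exact: sqr_ge0. Qed.

Lemma sqnorm_eq0 (R : realType) (d : nat) (x : 'rV[R]_d) :
  sqnorm x = 0 -> x = 0.
Proof.
move=> /eqP; rewrite psumr_eq0 => [/allP/= x0|j _]; last exact: sqr_ge0.
apply/rowP => j; rewrite mxE; apply/eqP.
by rewrite -sqrf_eq0; apply: x0; rewrite mem_index_enum.
Qed.

(** The subtracted term expresses strict convexity: its sign makes balls convex, its size makes
    nearest points unique. *)
Lemma sqnorm_conv (R : realType) (d : nat) (x y : 'rV[R]_d) (a b : R) :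
  a + b = 1 ->
  sqnorm (a *: x + b *: y) =
  a * sqnorm x + b * sqnorm y - a * b * sqnorm (x - y).
Proof.
move=> ab; rewrite /sqnorm !mulr_sumr -big_split/= -sumrB.
apply: eq_bigr => j _; rewrite !mxE.
have -> : b = 1 - a by lra.
by ring.
Qed.

Lemma sqnorm_continuous (R : realType) (d : nat) :
  continuous (@sqnorm R d).
Proof.
apply: continuous_sumr => j x.
have cj : continuous (fun y : 'rV[R]_d => y 0 j) by exact: coord_continuous.
exact: cvgM (cj x) (cj x).
Qed.

Lemma convex_set_ball (R : realType) (d : nat) (r : R) :
  convex_set [set x : 'rV[R]_d | sqnorm x < r].
Proof.
apply: convex_set_intro => x y a b /= xr yr a0 b0 ab.
rewrite sqnorm_conv//.
have := mulr_ge0 (mulr_ge0 a0 b0) (sqnorm_ge0 (x - y)).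
have [a1|a1] := ltP 0 a; first by nra.
by have [-> ->] : a = 0 /\ b = 1; lra.
Qed.

Definition minimizer (R : realType) (d : nat) (A : set 'rV[R]_d) :
    set 'rV[R]_d :=
  [set x | A x /\ forall y, A y -> sqnorm x <= sqnorm y].

(* Meaningful only when a minimizer exists; the value is [0] otherwise. *)
Definition nearest (R : realType) (d : nat) (A : set 'rV[R]_d) : 'rV[R]_d :=
  xget 0 (minimizer A).

Lemma nearest_min (R : realType) (d : nat) (A : set 'rV[R]_d) :
  A !=set0 -> compact A -> minimizer A (nearest A).
Proof.
move=> A0 cA; apply: xgetPex.
have [c /set_mem Ac cmin] := EVT_min_rV A0 cA
  (continuous_subspaceT (@sqnorm_continuous R d)).
by exists c; split => // y /mem_set/cmin.
Qed.

Lemma minimizer_unique (R : realType) (d : nat) (A : set 'rV[R]_d) x y :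
  convex_set A -> minimizer A x -> A y -> sqnorm y <= sqnorm x -> y = x.
Proof.
move=> cA [Ax xmin] Ay yx; apply/eqP; rewrite -subr_eq0; apply/eqP/sqnorm_eq0.
(* Minimality of [x] tested at the midpoint of [x] and [y] forces [sqnorm (y - x) <= 0]. *)
have h0 : 0 <= 2^-1 :> R by lra.
have h1 : 2^-1 + 2^-1 = 1 :> R by lra.
have := xmin _ (convex_set_comb cA Ay Ax h0 h0 h1).
rewrite sqnorm_conv//; have := sqnorm_ge0 (y - x); lra.
Qed.

(** * Compact convex hulls of finitely many points *)

Lemma simplex_compact (R : realType) (m : nat) :
  compact [set w : 'rV[R]_m | (forall i, 0 <= w 0 i) /\ \sum_i w 0 i = 1].
Proof.
apply: bounded_closed_compact.
  exists 1; split => // M M1 w [/= w0 w1].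
  apply: le_trans (ltW M1).
  rewrite /Num.norm/= mx_normrE; apply/bigmax_leP; split => // -[i j] _ /=.
  rewrite ord1 ger0_norm// -w1 (bigD1 j)//= lerDl.
  by apply: sumr_ge0.
rewrite [X in closed X](_ : _ =
    (\bigcap_i (fun w : 'rV[R]_m => w 0 i) @^-1` [set x | 0 <= x]) `&`
    (fun w : 'rV[R]_m => \sum_i w 0 i) @^-1` [set x | x = 1]); last first.
  by apply/seteqP; split => w [w0 w1]; split => // i; [move=> _|]; exact: w0.
apply: closedI.
- apply: closed_bigI => i _; apply: preimage_closed => [w _|].
    exact: coord_continuous.
  exact: closed_ge.
- apply: preimage_closed => [w _|]; last exact: closed_eq.
  by apply: continuous_sumr => i; exact: coord_continuous.
Qed.

(** The hull is the image of the standard simplex under the continuous barycentric map. *)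
Lemma finite_hull_ord (R : realType) (d m : nat) (z : 'I_m -> 'rV[R]_d)
    (D : set 'rV[R]_d) :
  convex_set D -> (forall i, D (z i)) ->
  exists K : set 'rV[R]_d,
    [/\ compact K, convex_set K, K `<=` D & forall i, K (z i)].
Proof.
move=> cD Dz.
pose S := [set w : 'rV[R]_m | (forall i, 0 <= w 0 i) /\ \sum_i w 0 i = 1].
pose f (w : 'rV[R]_m) := \sum_i w 0 i *: z i.
exists (f @` S); split.
- apply: continuous_compact; last exact: simplex_compact.
  apply: continuous_subspaceT; apply: continuous_sumr => i w.
  have ci : continuous (fun v : 'rV[R]_m => v 0 i) by exact: coord_continuous.
  exact: cvgZr_tmp (ci w).
- apply: convex_set_intro => _ _ a b [v [v0 v1] <-] [w [w0 w1] <-] a0 b0 ab.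
  exists (a *: v + b *: w).
    split=> [i|]; first by rewrite !mxE addr_ge0// mulr_ge0.
    under eq_bigr do rewrite !mxE.
    by rewrite big_split/= -!mulr_sumr v1 w1 !mulr1.
  rewrite /f !scaler_sumr -big_split/=; apply: eq_bigr => i _.
  by rewrite !mxE scalerDl !scalerA.
- move=> _ [w [w0 w1] <-]; rewrite -[f w]scale1r -[1]invr1 -w1.
  by apply: convex_set_sum => //; rewrite w1.
- move=> i; exists (delta_mx 0 i).
    split => [j|]; first by rewrite mxE ler0n.
    rewrite (bigD1 i)//= mxE !eqxx big1 ?addr0// => j ji.
    by rewrite mxE (negbTE ji).
  rewrite /f (bigD1 i)//= mxE !eqxx big1 ?addr0 ?scale1r// => j ji.
  by rewrite mxE (negbTE ji) scale0r.
Qed.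

Lemma finite_hull (R : realType) (d : nat) (U : finType) (Q : {set U})
    (z : U -> 'rV[R]_d) (D : set 'rV[R]_d) :
  convex_set D -> (forall u, u \in Q -> D (z u)) ->
  exists K : set 'rV[R]_d,
    [/\ compact K, convex_set K, K `<=` D & forall u, u \in Q -> K (z u)].
Proof.
move=> cD Dz.
have [i|K [cK vK KD Kz]] := @finite_hull_ord R d #|Q| (z \o enum_val) D cD.
  exact/Dz/enum_valP.
exists K; split => // u uQ.
by have := Kz (enum_rank_in uQ u); rewrite /= enum_rankK_in.
Qed.

(** * Nearest points of intersections of compact convex sets *)

Lemma convex_set_bigcap (R : realType) (V : lmodType R) (I : Type) (P : set I)
    (D : I -> set V) :
  (forall i, P i -> convex_set (D i)) -> convex_set (\bigcap_(i in P) D i).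
Proof.
move=> cD; apply: convex_set_intro => x y a b Dx Dy a0 b0 ab i Pi.
by apply: convex_set_comb => //; [exact: cD|exact: Dx|exact: Dy].
Qed.

Lemma compact_bigcap (R : realType) (d : nat) (T : Type) (P : set T) (i : T)
    (L : T -> set 'rV[R]_d) :
  P i -> (forall t, P t -> compact (L t)) -> compact (\bigcap_(t in P) L t).
Proof.
move=> Pi cL; apply: (@subclosed_compact _ _ (L i)) => [||x]; last exact.
  apply: closed_bigI => t Pt; apply: compact_closed; last exact: cL.
  exact: norm_hausdorff.
exact: cL.
Qed.

Lemma nearest_facet (R : realType) (d : nat) (T : finType) (I : {set T})
    (L : T -> set 'rV[R]_d) :
  (0 < d)%N -> #|I| = d.+1 ->
  (forall t, t \in I -> compact (L t)) ->
  (forall t, t \in I -> convex_set (L t)) ->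
  \bigcap_(t in [set` I]) L t !=set0 ->
  exists2 t, t \in I &
    (\bigcap_(u in [set` I]) L u) (nearest (\bigcap_(u in [set` I :\ t]) L u)).
Proof.
move=> d0 dI kL cL L0.
pose q t := nearest (\bigcap_(u in [set` I :\ t]) L u).
pose p := nearest (\bigcap_(u in [set` I]) L u).
have [i iI] : exists i, i \in I by apply/card_gt0P; rewrite dI.
have pmin : minimizer (\bigcap_(u in [set` I]) L u) p.
  by apply: nearest_min => //; exact: (@compact_bigcap _ _ _ _ i).
have qmin t : t \in I -> minimizer (\bigcap_(u in [set` I :\ t]) L u) (q t).
  move=> tI; apply: nearest_min.
    case: L0 => x Lx; exists x => u /=.
    by rewrite in_setD1 => /andP[_]; exact: Lx.
  (* Since [0 < d], some index remains; an empty intersection would be the whole space, which is not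
     compact. *)
  have [j jI] : exists j, j \in I :\ t.
    by apply/card_gt0P; have := cardsD1 t I; rewrite tI dI add1n => -[<-].
  apply: (@compact_bigcap _ _ _ _ j) => // u /=.
  by rewrite in_setD1 => /andP[_]; exact: kL.
apply: contrapT => noq.
(* If [q t] were not strictly nearer than [p], uniqueness in the larger intersection would give
   [p = q t], a point of all the sets. *)
have qp t : t \in I -> sqnorm (q t) < sqnorm p.
  move=> tI; rewrite ltNge; apply/negP => pq; apply: noq.
  exists t => //; rewrite -/(q t).
  have <- : p = q t; last by case: pmin.
  apply: minimizer_unique (qmin t tI) _ pq.
    apply: convex_set_bigcap => u /=.
    by rewrite in_setD1 => /andP[_]; exact: cL.
  by move=> u /=; rewrite in_setD1 => /andP[_ uI]; case: pmin => + _; exact.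
(* Helly's theorem for [d + 2] sets, where [None] indexes the open ball: [p] lies in every set but
   the ball, and [q t] in every set but possibly [L t]. *)
pose z (u : option T) := if u is Some t then q t else p.
pose D (u : option T) :=
  if u is Some t then L t else [set x | sqnorm x < sqnorm p].
have SI t : (Some t \in Some @: I) = (t \in I) by rewrite mem_imset// => ? ? [].
have NI : None \notin Some @: I by apply/imsetP => -[].
have [||u v|x Dx] := @helly_points R d _ (None |: Some @: I)%SET z D.
- by rewrite cardsU1 NI card_imset ?dI// => ? ? [].
- case=> [t|_]; last exact: convex_set_ball.
  by rewrite in_setU1/= SI; exact: cL.
- rewrite !in_setU1; case: u v => [t|] [s|]//=; rewrite ?SI.
  + move=> tI sI ts; case: (qmin s sI) => + _; apply.
    by rewrite /= in_setD1 tI andbT; apply: contra_neq ts => ->.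
  + by move=> tI _ _; case: pmin => + _; exact.
  + by move=> _ sI _; exact: qp.
(* The common point lies in all [L t] and is strictly nearer than [p]. *)
have := Dx None; rewrite in_setU1 eqxx => /(_ isT)/=.
apply/negP; rewrite -leNgt; case: pmin => _; apply => t /= tI.
by apply: (Dx (Some t)); rewrite in_setU1 SI.
Qed.

(** * Padding of unions, pigeonhole and counting of colourings *)

Lemma s_convex_bigcup (R : realType) (d s : nat) (A : set 'rV[R]_d) :
  s_convex s A -> exists C : 'I_s -> set 'rV[R]_d,
    (forall j, convex_set (C j)) /\ A = \bigcup_j C j.
Proof.
case=> k [C [ks cC ->]].
(* Padding with empty pieces lets the same colours ['I_s] serve every member. *)
exists (fun j => if insub (val j) is Some i then C i else set0); split.
  move=> j; case: insubP => [i _ _|_]; first exact: cC.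
  by move=> x y l; rewrite !inE.
apply/seteqP; split => [x [i _ Cx]|x [j _]].
  by exists (widen_ord ks i) => //=; rewrite valK.
by case: insubP => // i _ _ Cx; exists i.
Qed.

(** The fibres over [W] partition [G], and [y] is chosen with the largest one. *)
Lemma pigeonhole_fiber (X Y : finType) (G : {set X}) (W : {set Y}) (f : X -> Y) :
  (0 < #|G|)%N -> (forall x, x \in G -> f x \in W) ->
  exists y, (#|G| <= #|W| * #|[set x in G | f x == y]%SET|)%N.
Proof.
move=> /card_gt0P[x0 x0G] fW.
pose fib y := #|[set x in G | f x == y]%SET|.
have [y _ ymax] := @arg_maxnP _ (f x0) [in W] fib (fW _ x0G).
exists y; rewrite -[leqLHS]sum1_card (partition_big f [in W])//= -sum_nat_const.
apply: leq_sum => z zW; apply: leq_trans (ymax z zW).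
by rewrite /fib -sum1_card; under [leqRHS]eq_bigl do rewrite inE.
Qed.

(* A colouring of a [d]-subset is encoded by a total function equal to the
   default colour [j0] outside of it. *)
Lemma card_partial_colourings (n s d : nat) (j0 : 'I_s) :
  #|[set y : {set 'I_n} * {ffun 'I_n -> 'I_s} |
      (#|y.1| == d) && (y.2 \in pffun_on j0 (mem y.1) predT)]%SET|
  = ('C(n, d) * s ^ d)%N.
Proof.
transitivity (\sum_(A : {set 'I_n} | #|A| == d)
    \sum_(f : {ffun 'I_n -> 'I_s} | f \in pffun_on j0 (mem A) predT) 1)%N.
  by rewrite pair_big_dep /= sum1dep_card.
rewrite (eq_bigr (fun=> s ^ d)%N) => [|A /eqP Ad]; last first.
  by rewrite sum1_card card_pffun_on card_ord -Ad.
by rewrite sum_nat_const -cardsE card_draws card_ord.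
Qed.

(** * Encoding of the intersecting tuples and choice of the point *)

Theorem theorem1p3 (R : realType) (d s n : nat) (alpha : R)
    (F : 'I_n -> set 'rV[R]_d) :
  (1 <= d)%N -> (1 <= s)%N -> (d.+1 <= n)%N -> 0 < alpha ->
  (forall i, s_convex s (F i)) ->
  alpha * ('C(n, d.+1))%:R <= #|intersecting_tuples F|%:R ->
  exists x : 'rV[R]_d,
    alpha * n%:R / (d.+1%:R * s%:R ^+ d) <= #|[set i : 'I_n | `[< F i x >] ]%SET|%:R.
Proof.
move=> d1 s1 dn alpha0 cF; set G := intersecting_tuples F => alphaG.
have [C HC] := choice (fun i => s_convex_bigcup (cF i)).
have cC i j : convex_set (C i j) by case: (HC i).
have FC i : F i = \bigcup_j C i j by case: (HC i).
pose i0 : 'I_n := Ordinal (leq_trans (ltn0Sn d) dn).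
pose j0 : 'I_s := Ordinal s1.
have /choice[pc Hpc] (I : {set 'I_n}) : exists pc : 'rV[R]_d * ('I_n -> 'I_s),
    I \in G -> forall i, i \in I -> C i (pc.2 i) pc.1.
  have [IG|nIG] := boolP (I \in G); last by exists (0, fun=> j0).
  move: (IG); rewrite inE => /andP[_ /asboolP[x Fx]].
  have /choice[c Hc] i : exists j, i \in I -> C i j x.
    have [iI|niI] := boolP (i \in I); last by exists j0.
    by have := Fx i iI; rewrite FC => -[j _ Cx]; exists j.
  by exists (x, c).
pose p I := (pc I).1; pose c I := (pc I).2.
(* The witnesses for piece [u] are the chosen points of the tuples that use it; their hull [K u]
   replaces the piece. *)
pose Q (u : 'I_n * 'I_s) := [set I in G | (u.1 \in I) && (c I u.1 == u.2)]%SET.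
have /choice[K HK] (u : 'I_n * 'I_s) : exists K : set 'rV[R]_d,
    [/\ compact K, convex_set K, K `<=` C u.1 u.2 & forall I, I \in Q u -> K (p I)].
  apply: finite_hull => [|I]; first exact: cC.
  by rewrite inE => /and3P[IG uI /eqP <-]; exact: Hpc.
have KF i j x : K (i, j) x -> F i x.
  by rewrite FC => Kx; exists j => //; case: (HK (i, j)) => _ _ + _; exact.
pose q (A : {set 'I_n}) (f : 'I_n -> 'I_s) :=
  nearest (\bigcap_(i in [set` A]) K (i, f i)).
have /choice[t Ht] I : exists t, I \in G ->
    t \in I /\ (\bigcap_(i in [set` I]) K (i, c I i)) (q (I :\ t) (c I)).
  have [IG|nIG] := boolP (I \in G); last by exists i0.
  have [||||t tI qI] :=
    @nearest_facet R d _ I (fun i => K (i, c I i)) d1; last by exists t.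
  - by move: IG; rewrite inE => /andP[/eqP].
  - by move=> i _; case: (HK (i, c I i)).
  - by move=> i _; case: (HK (i, c I i)).
  - exists (p I) => i /= iI; case: (HK (i, c I i)) => _ _ _; apply.
    by rewrite inE IG /= iI eqxx.
(* Colours are reset to [j0] off [I :\ t I], so that a code records only [d] coloured indices; [q]
   is unaffected. *)
pose phi I : {set 'I_n} * {ffun 'I_n -> 'I_s} :=
  (I :\ t I, [ffun i => if i \in I :\ t I then c I i else j0]).
have qphi I : q (phi I).1 (phi I).2 = q (I :\ t I) (c I).
  by congr nearest; apply: eq_bigcapr => i /= iI; rewrite ffunE iI.
have cardG I : I \in G -> #|I| = d.+1 by rewrite inE => /andP[/eqP].
have cardphi I : I \in G -> #|(phi I).1| = d.
  move=> IG; have [tI _] := Ht I IG.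
  by have := cardsD1 (t I) I; rewrite tI (cardG I IG) add1n => -[].
have bB : ((d.+1)%:R * 'C(n, d.+1)%:R = (n - d)%:R * 'C(n, d)%:R :> R).
  by rewrite -!natrM mul_bin_left.
have B0 : 0 < 'C(n, d.+1)%:R :> R by rewrite ltr0n bin_gt0.
have b0 : 0 < 'C(n, d)%:R :> R by rewrite ltr0n bin_gt0 ltnW.
have G0 : (0 < #|G|)%N by rewrite -(ltr0n R) (lt_le_trans _ alphaG)// mulr_gt0.
have [|y] := @pigeonhole_fiber _ _ G
  [set y : {set 'I_n} * {ffun 'I_n -> 'I_s} |
    (#|y.1| == d) && (y.2 \in pffun_on j0 (mem y.1) predT)]%SET phi G0.
  move=> I IG; rewrite inE cardphi// eqxx /=; apply/pffun_onP; split => //.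
  by apply/supportP => i niI; rewrite ffunE (negbTE niI).
rewrite card_partial_colourings; set Y := [set _ in _ | _]%SET => GY.
have YP I : I \in Y -> I \in G /\ phi I = y.
  by rewrite inE => /andP[? /eqP].
(* A tuple in the fibre shows that [y] is an actual code, so [y.1] has [d] elements. *)
have [I1 I1Y] : exists I, I \in Y.
  by apply/card_gt0P; move: (leq_trans G0 GY); rewrite muln_gt0 => /andP[].
pose x := q y.1 y.2; exists x.
set N := [set _ | _]%SET.
have xF I i : I \in Y -> i \in I -> i \in N.
  move=> /YP[IG Iy] iI; rewrite inE; apply/asboolP.
  by apply: (KF _ (c I i)); rewrite /x -Iy qphi; case: (Ht I IG) => _; exact.
have yN : y.1 \subset N.
  apply/fintype.subsetP => i; have [_ <-] := YP _ I1Y.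
  by rewrite in_setD1 => /andP[_]; exact: xF.
have tN : t @: Y \subset N :\: y.1.
  apply/fintype.subsetP => _ /imsetP[I IY ->]; have [IG <-] := YP _ IY.
  rewrite finset.in_setD /= in_setD1 eqxx/=; apply: (xF I) => //.
  by case: (Ht I IG).
(* A tuple is recovered from its code and its removed index. *)
have tinj : {in Y &, injective t}.
  move=> I J IY JY tIJ; have [IG Iy] := YP _ IY; have [JG Jy] := YP _ JY.
  rewrite -(finset.setD1K (Ht I IG).1) -(finset.setD1K (Ht J JG).1) tIJ.
  by move: Iy; rewrite -Jy => -[]; rewrite tIJ => ->.
have cardN : (#|Y| + d <= #|N|)%N.
  have [I1G I1y] := YP _ I1Y.
  rewrite -(cardsID y.1 N) (finset.setIidPr yN) -{1}I1y cardphi// addnC leq_add2l.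
  by rewrite -(card_in_imset tinj) subset_leq_card.
(* This bound lets the [d] sets of the code account for the term [alpha * d] when [n - d] is raised
   to [n]. *)
have alpha1 : alpha <= 1.
  rewrite -(ler_pM2r B0) mul1r (le_trans alphaG)// ler_nat.
  have := card_draws 'I_n d.+1; rewrite card_ord => <-; apply: subset_leq_card.
  by apply/fintype.subsetP => I IG; rewrite inE cardG.
have sd1 : 1 <= s%:R ^+ d :> R by rewrite exprn_ege1// ler1n.
(* The identity [bB] trades ['C(n, d.+1)] for ['C(n, d)], which then cancels against the number of
   codes. *)
have alphaY : alpha * (n - d)%:R <= d.+1%:R * s%:R ^+ d * #|Y|%:R.
  rewrite -(ler_pM2r b0) -[leLHS]mulrA -bB mulrCA.
  have : alpha * 'C(n, d.+1)%:R <= 'C(n, d)%:R * s%:R ^+ d * #|Y|%:R.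
    by apply: le_trans alphaG _; rewrite -natrX -!natrM ler_nat.
  move/(ler_wpM2l (ler0n R d.+1))/le_trans; apply.
  by rewrite le_eqVlt; apply/orP; left; apply/eqP; ring.
rewrite ler_pdivrMr ?mulr_gt0 ?ltr0n ?exprn_gt0//; last by rewrite ltr0n.
have -> : n%:R = (n - d)%:R + d%:R :> R by rewrite -natrD subnK// ltnW.
have DS1 : 1 <= d.+1%:R * s%:R ^+ d :> R by rewrite mulr_ege1// ler1n.
rewrite mulrDr; apply: (@le_trans _ _ ((#|Y| + d)%:R * (d.+1%:R * s%:R ^+ d))).
  rewrite natrD mulrDl lerD//; first by rewrite [leRHS]mulrC.
  by rewrite [leRHS]mulrC ler_wpM2r// (le_trans alpha1).
by rewrite ler_wpM2r ?ler_nat// (le_trans ler01).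
Qed.
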